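(* Let $F\subset\{1,\dots,n\}$ be a strict subset and $p\in\{1,\dots,n\}\setminus F$. If $M$ is a $p$-kernel over $\mathcal{A}_n^F$ with $\operatorname{rank}M=d$ and matrices $K\in\mathbb{R}^{n\times d}$ and $H\in\mathbb{R}^{d\times n}$ satisfy $\operatorname{ran}K=(\ker M)^\perp$ and $\ker H=(\operatorname{ran}M)^\perp$, then $(p,M,MK,HMK,HM)$ is a representation of a frugal splitting operator over $\mathcal{A}_n^F$ with lifting number $d$. Furthermore, such matrices $K$ and $H$ exist for every $p$-kernel $M$ over $\mathcal{A}_n^F$.
   Context: Throughout, $\mathcal{H}$ is a real Hilbert space with $\dim\mathcal{H}\ge 2$, and $n\in\mathbb{N}_+=\{1,2,\dots\}$. A set-valued operator $A\colon\mathcal{H}\to2^{\mathcal{H}}$ is called single-valued if $Ax$ is a singleton for every $x\in\mathcal{H}$, and is then identified with a map. $J_A=(\mathrm{Id}+A)^{-1}$ is the resolvent, $\operatorname{zer}A=\{x: 0\in Ax\}$, $\operatorname{fix}T=\{z:Tz=z\}$. Orthogonal complements of ranges and kernels of matrices are with respect to the standard Euclidean inner product. Operator tuples: for $F\subseteq\{1,\dots,n\}$, $\mathcal{A}_n^F$ is the set of tuples $A=(A_1,\dots,A_n)$ where every $A_i\colon\mathcal{H}\to2^{\mathcal{H}}$ is maximally monotone and $A_i$ is single-valued for all $i\in F$. Parameterized operators: $T_{(\cdot)}\colon X\to Y$ parameterized by $\mathcal{A}_n^F$ means a map $T_A\colon X\to Y$ for each $A\in\mathcal{A}_n^F$. Matrices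 as operators: a matrix $B\in\mathbb{R}^{k\times m}$ acts on $z=(z_1,\dots,z_m)\in\mathcal{H}^m$ by $(Bz)_i=\sum_{j=1}^m B_{ij}z_j$, giving $Bz\in\mathcal{H}^k$. Primal-dual operator: for $A\in\mathcal{A}_n^F$ and $p\in\{1,\dots,n\}$, $\Phi_{A,p}=\Delta_{A,p}+\Gamma_p\colon\mathcal{H}^n\to2^{\mathcal{H}^n}$, where $\Delta_{A,p}(y_1,\dots,y_n)=\widehat{A}_1y_1\times\dots\times\widehat{A}_ny_n$ with $\widehat{A}_p=A_p$ and $\widehat{A}_i=A_i^{-1}$ for $i\ne p$, and $\Gamma_p=R_p-R_p^T\in\mathbb{R}^{n\times n}$, where $R_p$ has ones on the $p$th row and zeros elsewhere. Frugal splitting operator: for $d\in\mathbb{N}_+$, $T_{(\cdot)}\colon\mathcal{H}^d\to\mathcal{H}^d$ parameterized by $\mathcal{A}_n^F$ is a frugal splitting operator over $\mathcal{A}_n^F$ if there exist $d_1,\dots,d_{n+1}\in\mathbb{N}_+$ with $d_1=d_{n+1}=d$ and, for each $i\in\{1,\dots,n\}$, an operator $\tau_{i,(\cdot)}\colon\mathcal{H}^{d_i}\to\mathcal{H}^{d_{i+1}}$ parameterized by $\mathcal{A}_n^F$ such that, for all $A\in\mathcal{A}_n^F$: (1) $\operatorname{fix}T_A\neq\emptyset\iff\operatorname{zer}\sum_{i=1}^nA_i\ne\emptyset$; (2) $T_A=\tau_{n,A}\circ\tau_{n-1,A}\circ\cdots\circ\tau_{1,A}$; and moreover for each $i$ there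 exist $B_i\in\mathbb{R}^{d_{i+1}\times d_i}$, $C_i\in\mathbb{R}^{d_{i+1}\times1}$, $D_i\in\mathbb{R}^{1\times d_i}$, $\gamma_i>0$ (independent of $A$) such that for all $A\in\mathcal{A}_n^F$ and $z_i\in\mathcal{H}^{d_i}$, $\tau_{i,A}z_i=B_iz_i+C_iJ_{\gamma_iA_i}(D_iz_i)$ if $i\notin F$ and $\tau_{i,A}z_i=B_iz_i+C_iA_i(D_iz_i)$ if $i\in F$. Its lifting number is $d$. Representation: $T_{(\cdot)}\colon\mathcal{H}^d\to\mathcal{H}^d$ parameterized by $\mathcal{A}_n^F$ is a generalized primal-dual resolvent with representation $(p,M,N,U,V)$, where $p\in\{1,\dots,n\}$, $M\in\mathbb{R}^{n\times n}$, $N\in\mathbb{R}^{n\times d}$, $U\in\mathbb{R}^{d\times d}$, $V\in\mathbb{R}^{d\times n}$, if for all $A\in\mathcal{A}_n^F$ and all $z\in\mathcal{H}^d$, $(M+\Phi_{A,p})^{-1}\circ N$ is single-valued at $z$ and, with $y=(M+\Phi_{A,p})^{-1}Nz\in\mathcal{H}^n$, $T_Az=z-Uz+Vy$. $p$-kernel: $M\in\mathbb{R}^{n\times n}$ is a $p$-kernel over $\mathcal{A}_n^F$ if $p\notin F$, $M+\Gamma_p$ is lower triangular, $M_{i,i}\ge0$ for all $i\in\{1,\dots,n\}$, and $M_{i,i}=0$ if and only if $i\in F$. *)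

(* Defs.v *)
From HB Require Import structures.
From mathcomp Require Import all_boot all_order all_algebra.
From mathcomp Require Import all_classical all_reals all_analysis.

Set Implicit Arguments.
Unset Strict Implicit.
Unset Printing Implicit Defensive.

Import Order.TTheory GRing.Theory Num.Theory.
Import numFieldNormedType.Exports.

Local Open Scope classical_set_scope.
Local Open Scope ring_scope.

HB.mixin Record CompleteNormedModule_isHilbert (R : realType) H
    of CompleteNormedModule R H := {
  dotp : {dot H for idfun} ;
  dotp_norm : forall x : H, dotp x x = `|x| ^+ 2
}.

#[short(type="hilbertType")]
HB.structure Definition Hilbert (R : realType) :=
  {H of CompleteNormedModule R H & CompleteNormedModule_isHilbert R H}.

Definition dim_ge2 (R : realType) (H : hilbertType R) : Prop :=
  exists x y : H, forall a b : R, a *: x + b *: y = 0 -> a = 0 /\ b = 0.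

Section SetValued.
Variable R : realType.

Definition single_valued (X Y : Type) (A : X -> set Y) : Prop :=
  forall x, exists y, A x = [set y].

Definition opinv (X Y : Type) (A : X -> set Y) : Y -> set X :=
  fun y => [set x | A x y].

Definition op_of_map (X Y : Type) (f : X -> Y) : X -> set Y := fun x => [set f x].

Definition opadd (X : Type) (Y : lmodType R) (A B : X -> set Y) : X -> set Y :=
  fun x => [set u + v | u in A x & v in B x].

Definition opscale (X : Type) (Y : lmodType R) (g : R) (A : X -> set Y) :
    X -> set Y :=
  fun x => [set g *: u | u in A x].

Definition opsum (n : nat) (X : Type) (Y : lmodType R) (A : 'I_n -> X -> set Y) :
    X -> set Y :=
  fun x => [set \sum_i u i | u in [set u : 'I_n -> Y | forall i, A i x (u i)]].

Definition zer (X : Type) (Y : lmodType R) (A : X -> set Y) : set X :=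
  [set x | A x 0].

Definition fix_points (X : Type) (T : X -> X) : set X := [set z | T z = z].

Definition resolvent (X : lmodType R) (A : X -> set X) : X -> set X :=
  opinv (opadd (op_of_map idfun) A).

End SetValued.

Definition monotone_op (R : realType) (H : hilbertType R) (A : H -> set H) : Prop :=
  forall x y u v, A x u -> A y v -> 0 <= dotp (x - y) (u - v).

Definition maximally_monotone (R : realType) (H : hilbertType R)
    (A : H -> set H) : Prop :=
  monotone_op A /\
  forall B : H -> set H, monotone_op B -> (forall x, A x `<=` B x) -> B = A.

Record optuple (R : realType) (H : hilbertType R) (n : nat) (F : {set 'I_n}) :=
  OpTuple {
    opt :> 'I_n -> H -> set H ;
    opt_maxmono : forall i, maximally_monotone (opt i) ;
    opt_single_valued : forall i, i \in F -> single_valued (opt i)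
  }.

Definition parameterized (R : realType) (H : hilbertType R) (n : nat)
    (F : {set 'I_n}) (X Y : Type) : Type :=
  optuple H F -> X -> Y.

Definition mxact (R : realType) (H : lmodType R) (k m : nat) (B : 'M[R]_(k, m))
    (z : {ffun 'I_m -> H}) : {ffun 'I_k -> H} :=
  [ffun i => \sum_j B i j *: z j].

(* MathComp's own matrix kernels and images are row spaces; the sets below
   are the kernel and range for the action on column vectors. *)
Section ColumnSpaces.
Variable R : realType.

Definition mxran (k m : nat) (B : 'M[R]_(k, m)) : set 'cV[R]_k :=
  [set B *m x | x in setT].

Definition mxker (k m : nat) (B : 'M[R]_(k, m)) : set 'cV[R]_m :=
  [set x | B *m x = 0].

Definition orthc (k : nat) (S : set 'cV[R]_k) : set 'cV[R]_k :=
  [set y | forall x, S x -> \sum_i x i 0 * y i 0 = 0].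

End ColumnSpaces.

Definition Rmx (R : realType) (n : nat) (p : 'I_n) : 'M[R]_n :=
  \matrix_(i, j) (i == p)%:R.

Definition Gamma (R : realType) (n : nat) (p : 'I_n) : 'M[R]_n :=
  Rmx R p - (Rmx R p)^T.

Definition Delta (R : realType) (H : hilbertType R) (n : nat)
    (A : 'I_n -> H -> set H) (p : 'I_n) :
    {ffun 'I_n -> H} -> set {ffun 'I_n -> H} :=
  fun y => [set v | forall i, (if i == p then A i else opinv (A i)) (y i) (v i)].

Definition Phi (R : realType) (H : hilbertType R) (n : nat)
    (A : 'I_n -> H -> set H) (p : 'I_n) :
    {ffun 'I_n -> H} -> set {ffun 'I_n -> H} :=
  opadd (Delta A p) (op_of_map (mxact (Gamma R p))).

(* The condition that the inverse at [mxact N z] equals [set y] says both that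
   it is single-valued there and that y is its value. *)
Definition has_representation (R : realType) (H : hilbertType R) (n : nat)
    (F : {set 'I_n}) (d : nat)
    (T : parameterized H F {ffun 'I_d -> H} {ffun 'I_d -> H})
    (p : 'I_n) (M : 'M[R]_n) (N : 'M[R]_(n, d)) (U : 'M[R]_d) (V : 'M[R]_(d, n)) :
    Prop :=
  forall (A : optuple H F) (z : {ffun 'I_d -> H}),
  exists2 y : {ffun 'I_n -> H},
    opinv (opadd (op_of_map (mxact M)) (Phi A p)) (mxact N z) = [set y] &
    T A z = z - mxact U z + mxact V y.

Definition is_pkernel (R : realType) (n : nat) (F : {set 'I_n}) (p : 'I_n)
    (M : 'M[R]_n) : Prop :=
  [/\ p \notin F,
      is_trig_mx (M + Gamma R p),
      forall i, 0 <= M i i &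
      forall i, M i i = 0 <-> i \in F].

(* The row D is a map into H^1, whose only component is at index [ord0]; the
   column C acts on the constant tuple of H^1. *)
Definition is_frugal_step (R : realType) (H : hilbertType R) (n : nat)
    (F : {set 'I_n}) (i : 'I_n) (d d' : nat)
    (tau : parameterized H F {ffun 'I_d -> H} {ffun 'I_d' -> H}) : Prop :=
  exists (B : 'M[R]_(d', d)) (C : 'M[R]_(d', 1)) (D : 'M[R]_(1, d)) (g : R),
    0 < g /\
    forall (A : optuple H F) (z : {ffun 'I_d -> H}),
    exists2 u : H,
      (if i \in F then A i else resolvent (opscale g (A i))) (mxact D z ord0)
        = [set u] &
      tau A z = mxact B z + mxact C [ffun=> u].

(* [compose_steps f (k := k) _] is f_(k-1) \o ... \o f_0. *)
Fixpoint compose_steps (n : nat) (H : Type) (ds : nat -> nat)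
    (f : forall i : 'I_n, {ffun 'I_(ds i) -> H} -> {ffun 'I_(ds i.+1) -> H})
    (k : nat) : (k <= n)%N -> {ffun 'I_(ds 0%N) -> H} -> {ffun 'I_(ds k) -> H} :=
  match k with
  | 0 => fun _ z => z
  | k'.+1 => fun lt_k'n z =>
      f (Ordinal lt_k'n) (compose_steps f (ltnW lt_k'n) z)
  end.

Definition cast_pow (H : Type) (d d' : nat) (e : d = d') (z : {ffun 'I_d -> H}) :
    {ffun 'I_d' -> H} :=
  [ffun j => z (cast_ord (esym e) j)].

(* Indices start at 0: the i-th step uses A_i and maps H^(ds i) to H^(ds i.+1),
   so ds 0, ..., ds n are the dimensions and later values of ds are unused. *)
Definition is_frugal_splitting (R : realType) (H : hilbertType R) (n : nat)
    (F : {set 'I_n}) (d : nat)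
    (T : parameterized H F {ffun 'I_d -> H} {ffun 'I_d -> H}) : Prop :=
  exists (ds : nat -> nat) (e0 : d = ds 0%N) (en : ds n = d)
    (tau : forall i : 'I_n,
       parameterized H F {ffun 'I_(ds i) -> H} {ffun 'I_(ds i.+1) -> H}),
    [/\ forall k, (k <= n)%N -> (0 < ds k)%N,
        forall A : optuple H F,
          fix_points (T A) !=set0 <-> zer (opsum A) !=set0,
        forall (A : optuple H F) (z : {ffun 'I_d -> H}),
          T A z =
          cast_pow en (compose_steps (fun i => tau i A) (leqnn n) (cast_pow e0 z)) &
        forall i : 'I_n, is_frugal_step i (tau i)].

(* Main.v *)
Require Import Defs.
From mathcomp Require Import all_boot all_order all_algebra.
From mathcomp Require Import all_classical all_reals all_analysis.
From mathcomp Require Import ring lra.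

Set Implicit Arguments.
Unset Strict Implicit.
Unset Printing Implicit Defensive.

(** Write L for the lower triangular matrix M + Gamma_p; its diagonal is that
    of M, since Gamma_p is skew.  The inclusion b in (M + Phi_{A,p}) y reads,
    row by row,
      r_i - M_ii y_i  in  B_i y_i,   r_i = b_i - sum_(j < i) L_ij y_j,
    with B_p = A_p and B_i = A_i^-1 otherwise, so it is solved by forward
    substitution as soon as each row determines y_i from r_i.  It does: if
    M_ii = 0 then i lies in F and y_i = A_i r_i, while if M_ii > 0 then y_i is
    an affine combination of r_i and of one value of a resolvent of A_i
    ([row_solve]).  Resolvents are everywhere defined and single-valued by
    Minty's theorem, proved here ([minty0], [resolvent_single_valued]).  Hence
    (M + Phi)^-1 is single-valued everywhere ([pkernel_solve]), which defines T.

    The substitution evaluates each A_i once, in order, so T is a composition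
    of frugal steps.  They act on H^(d+n): the first d coordinates accumulate
    z - U z + V y and the last n hold the residuals r_i; only the first and the
    last step have to change the number of coordinates
    ([frugal_of_trajectory], [representation_frugal]).

    Fixed points correspond to zeros because the sum of the A_i has a zero if
    and only if Phi has one ([zer_opsumP]).  The range condition on K gives
    M = M K Q for some Q, and the kernel condition on its companion D gives
    M = G D M for some G ([factor_right], [factor_left]).  If T z = z then
    D M y = D M K z, so M y = M K z and 0 lies in Phi y; conversely a zero
    y of Phi yields the fixed point Q y ([representation_fix]).

    Transposes of the two factors of a full-rank factorisation of M serve as K
    and D ([exists_factors]). *)

Import Order.TTheory GRing.Theory Num.Theory.
Import numFieldNormedType.Exports.
Local Open Scope classical_set_scope.
Local Open Scope ring_scope.

(** * Inner products *)

Section InnerProduct.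
Variables (R : realType) (H : hilbertType R).
Implicit Types (x y z d : H) (a s : R).

Lemma dotpC x y : dotp x y = dotp y x.
Proof. by have := hermC (dotp : {dot H for idfun}) x y; rewrite expr0 mul1r. Qed.

Lemma dotpDl x y z : dotp (x + y) z = dotp x z + dotp y z.
Proof. exact: linearDl. Qed.

Lemma dotpNl x z : dotp (- x) z = - dotp x z.
Proof. exact: linearNl. Qed.

Lemma dotp0l z : dotp 0 z = 0.
Proof. exact: linear0l. Qed.

Lemma dotpZl a x z : dotp (a *: x) z = a * dotp x z.
Proof. exact: linearZl_LR. Qed.

Lemma dotpDr x y z : dotp z (x + y) = dotp z x + dotp z y.
Proof. by rewrite dotpC dotpDl !(dotpC z). Qed.

Lemma dotpNr x z : dotp z (- x) = - dotp z x.
Proof. by rewrite dotpC dotpNl dotpC. Qed.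

Lemma dotpZr a x z : dotp z (a *: x) = a * dotp z x.
Proof. by rewrite dotpC dotpZl dotpC. Qed.

Definition dotpE := (dotpDl, dotpDr, dotpNl, dotpNr, dotpZl, dotpZr).

Lemma dotp_sqD s x d :
  dotp (x + s *: d) (x + s *: d) = dotp x x + 2 * s * dotp x d + s * (s * dotp d d).
Proof. by rewrite !dotpE (dotpC d x); ring. Qed.

Lemma dotpp_ge0 x : 0 <= dotp x x.
Proof. by rewrite dotp_norm exprn_ge0. Qed.

Lemma dotpp_eq0 x : dotp x x <= 0 -> x = 0.
Proof.
move=> h; apply/eqP; rewrite -normr_eq0 -sqrf_eq0 -dotp_norm eq_le h.
exact: dotpp_ge0.
Qed.

(** Expressing the inner product through norms reduces its continuity to that
    of the norm. *)
Lemma polarization x y : dotp x y = 4%:R^-1 * (`|x + y| ^+ 2 - `|x - y| ^+ 2).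
Proof.
rewrite -!dotp_norm !dotpE (dotpC y x); set a := dotp x x; set b := dotp y y.
by field.
Qed.

Lemma cvg_dotp (x_ y_ : nat -> H) x y :
  x_ @ \oo --> x -> y_ @ \oo --> y ->
  (fun k => dotp (x_ k) (y_ k)) @ \oo --> (dotp x y : R).
Proof.
move=> xx yy; rewrite polarization.
have -> : (fun k => dotp (x_ k) (y_ k)) =
  (fun k => 4%:R^-1 * (`|x_ k + y_ k| ^+ 2 - `|x_ k - y_ k| ^+ 2)).
  by apply/funext => k; exact: polarization.
apply: cvgMl_tmp; apply: cvgB; apply: (@cvgM _ _ eventually); apply: cvg_norm.
- exact: cvgD.
- exact: cvgD.
- exact: cvgB.
- exact: cvgB.
Qed.

(** The estimate has the form that the parallelogram identity gives for a
    minimising sequence whose k-th term is within 1/(k+1) of the infimum. *)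
Lemma cvg_of_sq_dist (x_ : nat -> H) :
  (forall k l, dotp (x_ k - x_ l) (x_ k - x_ l) <=
     4 * (k.+1%:R^-1 + l.+1%:R^-1)) ->
  exists x : H, x_ @ \oo --> x.
Proof.
move=> near_x; apply/cvg_ex; apply/cauchy_cvgP; apply/cauchy_exP => e e0.
have e2 : 0 < e ^+ 2 / 8 by rewrite divr_gt0 ?exprn_gt0.
have near_small : \forall k \near \oo, (k.+1%:R^-1 : R) < e ^+ 2 / 8.
  exact: near_infty_natSinv_lt (PosNum e2).
have [N _ /(_ N (leqnn N)) /= hN] := near_small.
exists (x_ N); apply: filterS near_small => l /= hl; rewrite -ball_normE /=.
rewrite -(@ltr_pXn2r _ 2) ?nnegrE ?normr_ge0 ?(ltW e0) // -dotp_norm.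
apply: le_lt_trans (near_x N l) _.
by move: hN hl; set a := N.+1%:R^-1; set b := l.+1%:R^-1 => hN hl; lra.
Qed.

End InnerProduct.

(** * Minimising a convex function plus half the squared norm *)

Section QuadraticMinimisation.
Variables (R : realType) (H : hilbertType R).
Implicit Types (x y u v : H) (t : R).

Definition quad_perturb x u t : R := t + (dotp x x + dotp u u) / 2.

(** [E] plays the epigraph of a convex lower semicontinuous function on H x H,
    so no extended-real values are needed.  The quadratic term makes the
    objective strongly convex: comparing the midpoint of two almost minimal
    points with the infimum bounds their distance, so minimising sequences are
    Cauchy and completeness replaces weak compactness. *)
Lemma quad_perturb_attains_min (E : H -> H -> R -> Prop) (b : R) :
  (exists x u t, E x u t) ->
  (forall x u t, E x u t -> b <= quad_perturb x u t) ->
  (forall x u t x' u' t', E x u t -> E x' u' t' ->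
     E (2^-1 *: (x + x')) (2^-1 *: (u + u')) ((t + t') / 2)) ->
  (forall (x_ u_ : nat -> H) (t_ : nat -> R) x u t,
     (forall k, E (x_ k) (u_ k) (t_ k)) ->
     x_ @ \oo --> x -> u_ @ \oo --> u -> t_ @ \oo --> t -> E x u t) ->
  exists x u t, E x u t /\
    forall x' u' t', E x' u' t' -> quad_perturb x u t <= quad_perturb x' u' t'.
Proof.
move=> [x0 [u0 [t0 E0]]] E_ge E_mid E_closed.
pose S : set R := [set s | exists x u t, E x u t /\ quad_perturb x u t = s].
have S_inf : has_inf S.
  split; first by exists (quad_perturb x0 u0 t0), x0, u0, t0.
  by exists b => _ [x [u [t [Ext <-]]]]; exact: E_ge.
pose m := inf S.
have m_le x u t : E x u t -> m <= quad_perturb x u t.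
  by move=> Ext; apply: ge_inf; [exact: S_inf.2 | exists x, u, t].
have /choice[w_ w_min] : forall k : nat, exists w : H * H * R,
    E w.1.1 w.1.2 w.2 /\ quad_perturb w.1.1 w.1.2 w.2 < m + k.+1%:R^-1.
  move=> k; have k0 : 0 < k.+1%:R^-1 :> R by rewrite invr_gt0.
  by have [_ [x [u [t [Ext <-]]]] lt_m] := inf_adherent k0 S_inf; exists (x, u, t).
pose x_ k := (w_ k).1.1; pose u_ k := (w_ k).1.2; pose t_ k := (w_ k).2.
have Ew k : E (x_ k) (u_ k) (t_ k) by exact: (w_min k).1.
have q_lt k : quad_perturb (x_ k) (u_ k) (t_ k) < m + k.+1%:R^-1 by exact: (w_min k).2.
have dist_le k l : dotp (x_ k - x_ l) (x_ k - x_ l) +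
    dotp (u_ k - u_ l) (u_ k - u_ l) <= 4 * (k.+1%:R^-1 + l.+1%:R^-1).
  have := m_le _ _ _ (E_mid _ _ _ _ _ _ (Ew k) (Ew l)).
  have := q_lt k; have := q_lt l; rewrite /quad_perturb !dotpE.
  rewrite (dotpC (x_ l) (x_ k)) (dotpC (u_ l) (u_ k)).
  by set e1 := k.+1%:R^-1; set e2 := l.+1%:R^-1; lra.
have [x x_x] : exists x : H, x_ @ \oo --> x.
  apply: cvg_of_sq_dist => k l; apply: le_trans (dist_le k l).
  by rewrite lerDl dotpp_ge0.
have [u u_u] : exists u : H, u_ @ \oo --> u.
  apply: cvg_of_sq_dist => k l; apply: le_trans (dist_le k l).
  by rewrite lerDr dotpp_ge0.
(* The heights t_k need not be controlled separately: they converge because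
   the values of the objective and the points x_k, u_k do. *)
have q_m : (fun k => quad_perturb (x_ k) (u_ k) (t_ k)) @ \oo --> (m : R).
  apply: (@squeeze_cvgr _ _ _ _ (fun=> m) (fun k => m + k.+1%:R^-1)).
  - by near=> k; rewrite m_le //= ltW.
  - exact: cvg_cst.
  - rewrite -[X in _ --> X]addr0; apply: cvgD; first exact: cvg_cst.
    exact: cvg_harmonic.
pose t := m - (dotp x x + dotp u u) / 2.
have t_t : t_ @ \oo --> (t : R).
  have -> : t_ = (fun k => quad_perturb (x_ k) (u_ k) (t_ k) -
      (dotp (x_ k) (x_ k) + dotp (u_ k) (u_ k)) / 2).
    by apply/funext => k; rewrite /quad_perturb addrK.
  apply: cvgB => //; apply: cvgMr_tmp.
  by apply: cvgD; apply: cvg_dotp.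
exists x, u, t; split; first exact: E_closed Ew x_x u_u t_t.
by move=> x' u' t' /m_le; rewrite /quad_perturb /t subrK.
Unshelve. all: by end_near.
Qed.

End QuadraticMinimisation.

(** * Minty's theorem and resolvents *)

Section Minty.
Variables (R : realType) (H : hilbertType R).
Implicit Types (A : H -> set H) (x y u v : H).

(** Otherwise adding (x, u) to the graph of A would extend it properly. *)
Lemma maxmono_related A x u : maximally_monotone A ->
  (forall y v, A y v -> 0 <= dotp (x - y) (u - v)) -> A x u.
Proof.
move=> [A_mono A_max] rel.
pose B y := A y `|` [set v | y = x /\ v = u].
suff <- : B = A by right.
apply: A_max => [y z v w|y v]; last by left.
move=> [Ayv|[-> ->]] [Azw|[-> ->]].
- exact: A_mono.
- have := rel _ _ Ayv.
  by rewrite -(opprB x y) -(opprB u v) dotpNl dotpNr opprK.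
- exact: rel.
- by rewrite subrr dotp0l.
Qed.

(** The set [E] in the proof is the epigraph of the Fitzpatrick function
      F(x, u) = sup_{v in A y} <x, v> + <y, u> - <y, v>,
    which is convex, equals <y, v> on the graph of A and dominates <x, u>
    everywhere.  At a minimiser (x, u) of F + (|x|^2 + |u|^2) / 2, the
    first-order condition tested against (y, v) in the graph becomes
      |x + u|^2 <= <y + u, v + x>.
    Thus (-u, -x) is monotonically related to A, hence in its graph; testing
    against that point gives u = -x. *)
Lemma minty0 A : monotone_op A ->
  (forall x u, (forall y v, A y v -> 0 <= dotp (x - y) (u - v)) -> A x u) ->
  exists x, A x (- x).
Proof.
move=> A_mono A_max.
pose E x u (t : R) :=
  forall y v, A y v -> dotp x v + dotp y u - dotp y v <= t.
have E_graph y v : A y v -> E y v (dotp y v).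
  move=> Ayv y' v' Ay'v'; have := A_mono _ _ _ _ Ayv Ay'v'.
  by rewrite !dotpE; lra.
have E_ge x u t : E x u t -> dotp x u <= t.
  move=> Ext; rewrite leNgt; apply/negP => lt_t.
  have Axu : A x u.
    apply: A_max => y v Ayv; have := Ext _ _ Ayv; rewrite !dotpE; lra.
  by have := Ext _ _ Axu; lra.
have [x [u [t [Ext min_xut]]]] : exists x u t, E x u t /\
    forall x' u' t', E x' u' t' -> quad_perturb x u t <= quad_perturb x' u' t'.
  apply: (@quad_perturb_attains_min _ _ E 0).
  - have [[y [v Ayv]]|no_graph] := pselect (exists y v, A y v).
      by exists y, v, (dotp y v); exact: E_graph.
    exists 0, 0, 0 => y v Ayv; case: no_graph; by exists y, v.
  - move=> x u t /E_ge; have := dotpp_ge0 (x + u).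
    by rewrite /quad_perturb !dotpE (dotpC u x); lra.
  - move=> x u t x' u' t' E1 E2 y v Ayv; rewrite !dotpE.
    by have := E1 _ _ Ayv; have := E2 _ _ Ayv; lra.
  - move=> x_ u_ t_ x u t Ew x_x u_u t_t y v Ayv.
    apply: (@ler_cvg_to _ \oo _ _
      (fun k => dotp (x_ k) v + dotp y (u_ k) - dotp y v) t_) => //.
    + apply: cvgB; last exact: cvg_cst.
      by apply: cvgD; apply: cvg_dotp => //; exact: cvg_cst.
    + by near=> k; exact: Ew.
have opt y v : A y v -> dotp (x + u) (x + u) <= dotp (y + u) (v + x).
  move=> Ayv; have le_xu := E_ge _ _ _ Ext.
  set q := dotp (y - x) (y - x) + dotp (v - u) (v - u).
  have q_ge0 : 0 <= q by rewrite addr_ge0 ?dotpp_ge0.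
  suff : 0 <= dotp y v - t + dotp x (y - x) + dotp u (v - u).
    by rewrite !dotpE (dotpC y x) (dotpC u x) (dotpC u v); lra.
  (* Moving a fraction s from the minimiser towards (y, v) changes the
     objective by s times the right-hand side plus s^2 q / 2; taking
     s = e / (e + q) makes the second-order term at most s e. *)
  apply/ler_addgt0Pl => e e0.
  have den_gt0 : 0 < 1 + q / e by rewrite ltr_pwDl // divr_ge0 // ltW.
  pose s : R := (1 + q / e)^-1.
  have s0 : 0 < s by rewrite invr_gt0.
  have s1 : s <= 1 by rewrite invf_le1 // lerDl divr_ge0 // ltW.
  have sq : s * q <= e.
    rewrite /s mulrC ler_pdivrMr // mulrDr mulr1 mulrCA divff ?gt_eqF //.
    by rewrite mulr1 lerDr ltW.
  have : E (x + s *: (y - x)) (u + s *: (v - u)) (t + s * (dotp y v - t)).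
    move=> y' v' Ay'v'; have := Ext _ _ Ay'v'.
    by have := E_graph _ _ Ayv _ _ Ay'v'; rewrite !dotpE => h1 h2; nra.
  move=> /min_xut; rewrite /quad_perturb !dotp_sqD => le_s.
  by rewrite -(pmulr_rge0 _ s0); rewrite /q in sq; nra.
have Aux : A (- u) (- x).
  apply: A_max => y v /opt le_xu; apply: le_trans (dotpp_ge0 (x + u)) _.
  apply: le_trans le_xu _.
  by rewrite -!opprD dotpNl dotpNr opprK (addrC u) (addrC x).
have xu : x + u = 0.
  apply: dotpp_eq0; apply: le_trans (opt _ _ Aux) _.
  by rewrite addNr dotp0l.
by exists x; rewrite -{1}(addrK u x) xu add0r.
Unshelve. all: by end_near.
Qed.

End Minty.

Section Resolvent.
Variables (R : realType) (H : hilbertType R).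
Implicit Types (A : H -> set H) (x y u v r : H) (g : R).

Lemma resolventE A g r x : 0 < g ->
  resolvent (opscale g A) r x <-> A x (g^-1 *: (r - x)).
Proof.
move=> g0; split.
  move=> [_ -> [_ [v Axv <-] <-]].
  by rewrite addrC addKr scalerK ?gt_eqF.
move=> Axr; exists x => //; exists (r - x); last by rewrite addrC subrK.
by exists (g^-1 *: (r - x)); rewrite ?scalerKV ?gt_eqF.
Qed.

(** Existence is [minty0] for x |-> g A x - r, which inherits from A both its
    monotonicity and the presence of every monotonically related pair. *)
Lemma resolvent_single_valued A g : maximally_monotone A -> 0 < g ->
  single_valued (resolvent (opscale g A)).
Proof.
move=> A_maxmono g0 r; have A_mono := A_maxmono.1.
have gN0 : g != 0 by rewrite gt_eqF.
pose B x : set H := [set w | A x (g^-1 *: (w + r))].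
have [x Bx] : exists x, B x (- x).
  apply: minty0 => [x y w w' Bxw Byw'|x w rel].
    have := A_mono _ _ _ _ Bxw Byw'; rewrite -scalerBr dotpZr pmulr_rge0 ?invr_gt0 //.
    by rewrite opprD addrACA subrr addr0.
  apply: (maxmono_related A_maxmono) => y v Ayv.
  have /rel : B y (g *: v - r) by rewrite /B /= subrK scalerK.
  have -> : w - (g *: v - r) = g *: (g^-1 *: (w + r) - v).
    by rewrite scalerBr scalerKV // opprB addrA addrAC.
  by rewrite dotpZr pmulr_rge0.
exists x; apply/seteqP; split => [y|_ ->] /=; rewrite resolventE //; last first.
  by rewrite addrC.
move=> Ay; apply/eqP; rewrite -subr_eq0; apply/eqP/dotpp_eq0.
have := A_mono _ _ _ _ Ay Bx; rewrite -scalerBr dotpZr pmulr_rge0 ?invr_gt0 //.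
by rewrite opprD opprK (addrC (r - y)) addrA subrK -(opprB y) dotpNr oppr_ge0.
Qed.

End Resolvent.

(** * Solving one row of the inclusion *)

(** Coefficients of the rule y = alpha r + beta u, where u is the value at
    delta r of A_i or of the resolvent of gamma A_i; they may depend on the row
    but not on the operators, as frugality demands. *)
Record row_coef (R : realType) := RowCoef {
  rc_gamma : R; rc_delta : R; rc_alpha : R; rc_beta : R
}.

Section RowSolve.
Variables (R : realType) (H : hilbertType R) (n : nat) (F : {set 'I_n}).

Definition oracle (A : optuple H F) (i : 'I_n) (g : R) : H -> set H :=
  if i \in F then A i else resolvent (opscale g (A i)).

Definition pd_op (A : optuple H F) (p i : 'I_n) : H -> set H :=
  if i == p then A i else opinv (A i).

(** For m > 0 the inclusion with A itself says that y is the resolvent of A / m at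
    r / m.  With A^-1 it says that y is in A (r - m y), so that
    x = r - m y satisfies r in x + m A x and y = (r - x) / m.  For m = 0 it
    reads r in A^-1 y, which is y = A r as A is single-valued. *)
Lemma row_solve (p i : 'I_n) (m : R) : p \notin F -> 0 <= m ->
  (m = 0 <-> i \in F) ->
  exists c : row_coef R, 0 < rc_gamma c /\
    forall (A : optuple H F) (r : H), exists u : H,
      oracle A i (rc_gamma c) (rc_delta c *: r) = [set u] /\
      forall y, pd_op A p i y (r - m *: y) <->
                y = rc_alpha c *: r + rc_beta c *: u.
Proof.
rewrite /oracle /pd_op; move=> pNF m_ge0 m_eq0; case: (boolP (i \in F)) => iF.
  exists (RowCoef 1 1 0 1); split=> // A r /=.
  have -> : (i == p) = false by apply: contraNF pNF => /eqP <-.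
  have [u Aru] := opt_single_valued A iF r.
  exists u; rewrite !scale1r; split=> // y; rewrite scale0r add0r /opinv /=.
  by rewrite (m_eq0.2 iF) scale0r subr0 Aru.
have m0 : m != 0 by apply: contraNneq iF => /m_eq0.
have m_gt0 : 0 < m by rewrite lt_def m0.
have [->|iNp] := eqVneq i p.
  exists (RowCoef m^-1 m^-1 0 1); split=> [|A r] /=; first by rewrite invr_gt0.
  have mV0 : 0 < m^-1 by rewrite invr_gt0.
  have [u Au] := resolvent_single_valued (opt_maxmono A p) mV0 (m^-1 *: r).
  exists u; split=> // y; rewrite scale0r add0r scale1r.
  have := resolventE (A p) (m^-1 *: r) y mV0.
  by rewrite Au /= invrK scalerBr scalerKV // => ->.
exists (RowCoef m 1 m^-1 (- m^-1)); split=> // A r /=.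
have [u Au] := resolvent_single_valued (opt_maxmono A i) m_gt0 r.
exists u; rewrite scale1r; split=> // y; rewrite /opinv /=.
have := resolventE (A i) r (r - m *: y) m_gt0.
rewrite Au /= subKr scalerK // => <-; rewrite scaleNr -scalerBr; split=> [<-|->].
  by rewrite subKr scalerK.
by rewrite scalerKV // subKr.
Qed.

End RowSolve.

(** * Forward substitution *)

Section Triangular.
Variables (R : realType) (V : lmodType R) (n : nat).

(** Solutions of the equations below k agree on the entries below k, and each
    extends to entry k because equation k only reads the earlier entries. *)
Lemma forward_substitution (L : 'M[R]_n) (b : {ffun 'I_n -> V})
    (f : 'I_n -> V -> V) :
  exists y : {ffun 'I_n -> V}, forall y' : {ffun 'I_n -> V},
    (forall i, y' i = f i (b i - \sum_(j < n | (j < i)%N) L i j *: y' j)) <->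
    y' = y.
Proof.
pose sol k (y : {ffun 'I_n -> V}) := forall i : 'I_n, (i < k)%N ->
  y i = f i (b i - \sum_(j < n | (j < i)%N) L i j *: y j).
have sol_uniq k y y' : sol k y -> sol k y' -> forall i : 'I_n, (i < k)%N -> y i = y' i.
  elim: k => // k IHk sy sy' i; rewrite ltnS leq_eqVlt => /orP[/eqP ik|]; last first.
    by apply: IHk => j jk; [apply: sy|apply: sy']; exact: ltnW.
  rewrite sy ?sy' ?ik //; congr (f i (_ - _)); apply: eq_bigr => j jk.
  by congr (_ *: _); apply: IHk => // l lk; [apply: sy|apply: sy']; exact: ltnW.
have sol_ex k : exists y, sol k y.
  elim: k => [|k [y sy]]; first by exists [ffun=> 0].
  exists [ffun i : 'I_n => if i == k :> nat
    then f i (b i - \sum_(j < n | (j < i)%N) L i j *: y j) else y i] => i ik.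
  have -> : \sum_(j < n | (j < i)%N) L i j *: [ffun i : 'I_n => if i == k :> nat
    then f i (b i - \sum_(j < n | (j < i)%N) L i j *: y j) else y i] j =
    \sum_(j < n | (j < i)%N) L i j *: y j.
    apply: eq_bigr => j ji; rewrite ffunE ltn_eqF //.
    exact: leq_trans ji ik.
  rewrite ffunE; case: eqP => // /eqP ik'; apply: sy.
  by rewrite ltn_neqAle ik' -ltnS.
have [y sy] := sol_ex n; exists y => y'; split=> [sy'|->]; last by move=> i; exact: sy.
by apply/ffunP => i; apply: (sol_uniq n) => // j _; exact: sy'.
Qed.

End Triangular.

(** * Factorisations from ranges and kernels *)

Section Matrices.
Variable R : realType.

Lemma dotcol (k : nat) (x y : 'cV[R]_k) :
  \sum_i x i 0 * y i 0 = (x^T *m y) 0 0.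
Proof. by rewrite !mxE; apply: eq_bigr => i _; rewrite !mxE. Qed.

Lemma trmx_mul_eq0 (k : nat) (x : 'cV[R]_k) : x^T *m x = 0 -> x = 0.
Proof.
move=> /matrixP/(_ 0 0); rewrite -dotcol mxE => /eqP.
rewrite psumr_eq0 => [/allP x0|i _]; last by rewrite -expr2 sqr_ge0.
apply/matrixP => i j; rewrite ord1 mxE; apply/eqP.
by have := x0 i (mem_index_enum _); rewrite mulf_eq0 orbb.
Qed.

(** It suffices to test the inclusion on the columns of [cokermx B], which lie
    in the kernel of B. *)
Lemma submx_of_ker (k l m : nat) (A : 'M[R]_(k, m)) (B : 'M[R]_(l, m)) :
  (forall x : 'cV[R]_m, B *m x = 0 -> A *m x = 0) -> exists G, A = G *m B.
Proof.
move=> kerBA; apply/submxP; rewrite submxE; apply/eqP/matrixP => i j.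
have : A *m col j (cokermx B) = 0.
  by apply: kerBA; rewrite colE mulmxA mulmx_coker mul0mx.
by rewrite colE mulmxA -colE => /matrixP/(_ i 0); rewrite !mxE.
Qed.

Lemma mulmx_col_eq (k l m : nat) (A : 'M[R]_(k, m)) (B : 'M[R]_(k, l)) :
  (forall j, exists x : 'cV[R]_l, B *m x = col j A) -> exists Z, A = B *m Z.
Proof.
move=> /choice[x Bx]; exists (\matrix_(i, j) x j i 0).
apply/matrixP => i j; have /matrixP/(_ i 0) := Bx j.
by rewrite !mxE => <-; apply: eq_bigr => l' _; rewrite !mxE.
Qed.

(** The columns of M^T are orthogonal to ker M, so M^T = K Z; moreover M and
    M M^T have the same range, over an ordered field, so M = M M^T Y^T. *)
Lemma factor_right (k l m : nat) (M : 'M[R]_(k, m)) (K : 'M[R]_(m, l)) :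
  orthc (mxker M) `<=` mxran K -> exists Q, M = M *m K *m Q.
Proof.
move=> sub_ran.
have [Z MZ] : exists Z, M^T = K *m Z.
  apply: mulmx_col_eq => j; have [|x _ Kx] := sub_ran (col j M^T); last by exists x.
  move=> w Mw0; rewrite dotcol.
  have -> : w^T *m col j M^T = (row j (M *m w))^T.
    by rewrite row_mul trmx_mul tr_row.
  by rewrite Mw0 row0 trmx0 mxE.
have [Y MY] : exists Y, M^T = Y *m (M *m M^T).
  apply: submx_of_ker => x Mx0; apply: trmx_mul_eq0.
  by rewrite trmx_mul trmxK -mulmxA [M *m _]mulmxA Mx0 mulmx0.
exists (Z *m Y^T); rewrite -mulmxA [K *m _]mulmxA -MZ.
by rewrite -[LHS]trmxK {1}MY !trmx_mul trmxK mulmxA.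
Qed.

(** If L M x = 0 then M x is orthogonal to ran M, hence to itself, so M x = 0:
    the kernel of L M lies in that of M. *)
Lemma factor_left (k l m : nat) (M : 'M[R]_(k, m)) (L : 'M[R]_(l, k)) :
  mxker L `<=` orthc (mxran M) -> exists G, M = G *m (L *m M).
Proof.
move=> sub_orth; apply: submx_of_ker => x LMx0; apply: trmx_mul_eq0.
have : mxker L (M *m x) by rewrite /mxker /= mulmxA.
move=> /sub_orth/(_ (M *m x)) orth; apply/matrixP => i j.
by rewrite !ord1 -dotcol mxE orth //; exists x.
Qed.

Lemma exists_factors (n : nat) (M : 'M[R]_n) :
  exists (K : 'M[R]_(n, \rank M)) (L : 'M[R]_(\rank M, n)),
     mxran K = orthc (mxker M) /\ mxker L = orthc (mxran M).
Proof.
have [G baseG] : exists G, row_base M = G *m M.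
  by apply/submxP; rewrite eq_row_base.
exists (row_base M)^T, (col_base M)^T; split; apply/seteqP; split => y /=.
- move=> [x _ <-] w Mw0; rewrite dotcol mulmxA -trmx_mul baseG -mulmxA Mw0.
  by rewrite mulmx0 trmx0 mul0mx mxE.
- move=> y_orth.
  have [Z yZ] : exists Z, y^T = Z *m row_base M.
    apply: submx_of_ker => w Mw0; apply/matrixP => i j; rewrite !ord1.
    rewrite -[y^T *m w]trmxK trmx_mul trmxK [LHS]mxE -dotcol [RHS]mxE.
    by apply: y_orth; rewrite /mxker /= -[M]mulmx_base -mulmxA Mw0 mulmx0.
  by exists Z^T => //; rewrite -trmx_mul -yZ trmxK.
- move=> Ly0 _ [x _ <-]; rewrite dotcol -[M in M *m x]mulmx_base.
  by rewrite -mulmxA trmx_mul -mulmxA Ly0 mulmx0 mxE.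
- move=> y_orth.
  have : M^T *m y = 0.
    apply: trmx_mul_eq0; apply/matrixP => i j; rewrite !ord1.
    rewrite trmx_mul trmxK -mulmxA -[y^T *m _]trmxK trmx_mul trmxK [LHS]mxE.
    rewrite -dotcol [RHS]mxE; apply: y_orth.
    by exists (M^T *m y).
  rewrite -{1}[M]mulmx_base trmx_mul -mulmxA => h.
  have : (pinvmx (row_base M))^T *m ((row_base M)^T *m ((col_base M)^T *m y)) = 0.
    by rewrite h mulmx0.
  by rewrite mulmxA -trmx_mul mulmxVp ?row_base_free // trmx1 mul1mx.
Qed.

End Matrices.

(** * Matrices acting on tuples of vectors *)

Section MatrixAction.
Variables (R : realType) (V : lmodType R).

Lemma mxactM (k l m : nat) (A : 'M[R]_(k, l)) (B : 'M[R]_(l, m)) (z : {ffun 'I_m -> V}) :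
  mxact (A *m B) z = mxact A (mxact B z).
Proof.
apply/ffunP => i; rewrite !ffunE.
under [RHS]eq_bigr do rewrite ffunE scaler_sumr.
rewrite exchange_big; apply: eq_bigr => j _; rewrite mxE scaler_suml.
by apply: eq_bigr => l' _; rewrite scalerA.
Qed.

Lemma mxact1 (k : nat) (z : {ffun 'I_k -> V}) : mxact 1%:M z = z.
Proof.
apply/ffunP => i; rewrite !ffunE (bigD1 i) //= big1 => [|j ji].
  by rewrite mxE eqxx scale1r addr0.
by rewrite mxE eq_sym (negbTE ji) scale0r.
Qed.

Lemma mxactDl (k m : nat) (A B : 'M[R]_(k, m)) (z : {ffun 'I_m -> V}) :
  mxact (A + B) z = mxact A z + mxact B z.
Proof.
apply/ffunP => i; rewrite !ffunE -big_split; apply: eq_bigr => j _.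
by rewrite mxE scalerDl.
Qed.

Lemma mxactNl (k m : nat) (A : 'M[R]_(k, m)) (z : {ffun 'I_m -> V}) :
  mxact (- A) z = - mxact A z.
Proof.
apply/ffunP => i; rewrite !ffunE -sumrN; apply: eq_bigr => j _.
by rewrite mxE scaleNr.
Qed.

Lemma mxactZl (k m : nat) a (A : 'M[R]_(k, m)) (z : {ffun 'I_m -> V}) i :
  mxact (a *: A) z i = a *: mxact A z i.
Proof.
by rewrite !ffunE scaler_sumr; apply: eq_bigr => j _; rewrite mxE scalerA.
Qed.

Lemma mxactDr (k m : nat) (A : 'M[R]_(k, m)) (z z' : {ffun 'I_m -> V}) :
  mxact A (z + z') = mxact A z + mxact A z'.
Proof.
apply/ffunP => i; rewrite !ffunE -big_split; apply: eq_bigr => j _.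
by rewrite ffunE scalerDr.
Qed.

Lemma mxact0 (k m : nat) (A : 'M[R]_(k, m)) : mxact A (0 : {ffun 'I_m -> V}) = 0.
Proof. by apply/ffunP => i; rewrite !ffunE big1 // => j _; rewrite ffunE scaler0. Qed.

Lemma mxact_col (k m : nat) (A : 'M[R]_(k, m)) j (v : V) :
  mxact (col j A) [ffun=> v] = mxact A [ffun j' => if j' == j then v else 0].
Proof.
apply/ffunP => i; rewrite !ffunE big_ord1 !ffunE mxE (bigD1 j) //= ffunE eqxx.
by rewrite big1 ?addr0 // => l /negbTE lj; rewrite ffunE lj scaler0.
Qed.

Lemma mxact_delta (m : nat) (j : 'I_m) (z : {ffun 'I_m -> V}) :
  mxact (delta_mx 0 j : 'rV[R]_m) z = [ffun=> z j].
Proof.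
apply/ffunP => i; rewrite !ffunE (bigD1 j) //= big1 => [|l /negbTE lj].
  by rewrite mxE ord1 !eqxx scale1r addr0.
by rewrite mxE lj andbF scale0r.
Qed.

(** Turning transports along equations of dimensions into partial identity
    matrices lets them be absorbed by the matrices around them. *)
Lemma cast_pow_pid (d d' : nat) (e : d = d') (z : {ffun 'I_d -> V}) :
  cast_pow e z = mxact (pid_mx d) z.
Proof.
subst d'; rewrite pid_mx_1 mxact1; apply/ffunP => i.
by rewrite ffunE cast_ord_id.
Qed.

End MatrixAction.

(** * Compositions of frugal steps *)

Section FrugalSteps.
Variables (R : realType) (H : hilbertType R) (n : nat) (F : {set 'I_n}).

Lemma is_frugal_step_mul (i : 'I_n) (d d' m m' : nat) (E : 'M[R]_(m, d))
    (P : 'M[R]_(d', m')) (S : parameterized H F {ffun 'I_m -> H} {ffun 'I_m' -> H}) :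
  is_frugal_step i S ->
  is_frugal_step i ((fun A z => mxact P (S A (mxact E z))) :
    parameterized H F {ffun 'I_d -> H} {ffun 'I_d' -> H}).
Proof.
move=> [B [C [D [g [g0 S_eq]]]]].
exists (P *m B *m E), (P *m C), (D *m E), g; split=> // A z.
have [u Au Sz] := S_eq A (mxact E z).
by exists u; rewrite mxactM // Sz mxactDr !mxactM.
Qed.

(** Steps with a common state space H^m, entered through [W] and left through
    [Q], form a frugal splitting operator: [W] is merged into the first step
    and [Q] into the last one.  Working with a trajectory avoids naming the
    iterated composition. *)
Lemma frugal_of_trajectory (d m : nat) (W : 'M[R]_(m, d)) (Q : 'M[R]_(d, m))
    (S : 'I_n -> parameterized H F {ffun 'I_m -> H} {ffun 'I_m -> H})
    (T : parameterized H F {ffun 'I_d -> H} {ffun 'I_d -> H}) :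
  (0 < n)%N -> (0 < d)%N -> (0 < m)%N ->
  (forall i, is_frugal_step i (S i)) ->
  (forall A z, exists X : nat -> {ffun 'I_m -> H},
     [/\ X 0%N = mxact W z, forall i : 'I_n, X i.+1 = S i A (X i) &
         T A z = mxact Q (X n)]) ->
  (forall A : optuple H F, fix_points (T A) !=set0 <-> zer (opsum A) !=set0) ->
  is_frugal_splitting T.
Proof.
move=> n0 d0 m0 S_step T_traj T_fix.
(* The partial identities below are identity matrices between dimensions that
   are equal only propositionally, which spares all casts of matrices. *)
pose ds k := if (0 < k < n)%N then m else d.
have dsn : ds n = d by rewrite /ds ltnn andbF.
pose E k : 'M[R]_(m, ds k) := if k == 0%N then W *m pid_mx d else pid_mx m.
pose P k : 'M[R]_(ds k, m) := if (k < n)%N then pid_mx m else pid_mx d *m Q.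
exists ds, erefl, dsn,
  (fun (i : 'I_n) (A : optuple H F) z => mxact (P i.+1) (S i A (mxact (E i) z))).
split=> // [k _|A z|i]; first by rewrite /ds; case: ifP.
  have [X [X0 XS ->]] := T_traj A z.
  set tau := (fun i : 'I_n => _).
  have tauE i x : tau i x = mxact (P i.+1) (S i A (mxact (E i) x)) by [].
  have inv k (lt_kn : (k < n)%N) :
      mxact (E k) (compose_steps tau (ltnW lt_kn) (cast_pow erefl z)) = X k.
    elim: k lt_kn => [|k IHk] lt_kn /=.
      rewrite cast_pow_pid /E eqxx mxactM -(mxactM (pid_mx d)).
      by rewrite pid_mx_id // pid_mx_1 mxact1.
    rewrite tauE /= IHk.
    rewrite -mxactM /E /P lt_kn /= -(XS (Ordinal (ltnW lt_kn))).
    have -> : (pid_mx m : 'M[R]_(m, ds k.+1)) *m (pid_mx m : 'M[R]_(ds k.+1, m)) = 1%:M.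
      by rewrite /ds /= lt_kn pid_mx_id // pid_mx_1.
    by rewrite mxact1.
  have final k (e : ds k = d) (le_kn : (k <= n)%N) : k = n ->
      cast_pow e (compose_steps tau le_kn (cast_pow erefl z)) = mxact Q (X k).
    case: k e le_kn => [|k] e le_kn kn; first by rewrite -kn in n0.
    rewrite /= tauE /= inv.
    rewrite -(XS (Ordinal le_kn)) cast_pow_pid /P kn ltnn -mxactM mulmxA /=.
    by congr (mxact _ _); rewrite -[RHS]mul1mx -kn e pid_mx_id // pid_mx_1.
  by rewrite final.
exact: is_frugal_step_mul.
Qed.

End FrugalSteps.

(** * The primal-dual inclusion *)

Section PrimalDual.
Variables (R : realType) (H : hilbertType R) (n : nat) (F : {set 'I_n}).
Variables (p : 'I_n) (M : 'M[R]_n).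
Implicit Types (A : optuple H F) (y b : {ffun 'I_n -> H}).

Lemma pd_inclusionP A b y :
  opinv (opadd (op_of_map (mxact M)) (Phi A p)) b y <->
  forall i, pd_op A p i (y i) (b i - mxact (M + Gamma R p) y i).
Proof.
rewrite mxactDl; split.
  move=> [_ -> [_ [v Dv [_ -> <-]] <-]] i; have := Dv i.
  set g := mxact (Gamma R p) y; set m := mxact M y.
  rewrite /pd_op; suff -> : (m + (v + g)) i - (m + g) i = v i by [].
  by rewrite addrCA [(v + _) i]ffunE addrK.
move=> row_y; exists (mxact M y) => //.
exists (b - mxact M y); last by rewrite addrC subrK.
exists (b - mxact M y - mxact (Gamma R p) y); last first.
  by exists (mxact (Gamma R p) y); rewrite ?subrK.
move=> i; have := row_y i; rewrite /pd_op.
by rewrite -[_ - _ - _]addrA -opprD !ffunE.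
Qed.

Lemma mxact_Gamma y i :
  mxact (Gamma R p) y i = (if i == p then \sum_j y j else 0) - y p.
Proof.
rewrite /Gamma mxactDl mxactNl !ffunE; congr (_ - _).
  case: ifP => ip; [apply: eq_bigr|apply: big1] => j _; rewrite mxE ip.
    by rewrite scale1r.
  by rewrite scale0r.
rewrite (bigD1 p) //= big1 => [|j jp]; first by rewrite !mxE eqxx scale1r addr0.
by rewrite !mxE (negbTE jp) scale0r.
Qed.

(** The right-hand side says that Phi has a zero.  Row i <> p reads
    y_i in A_i y_p and row p reads - sum_(j <> p) y_j in A_p y_p, so y_p is a
    zero of the sum. *)
Lemma zer_opsumP A : zer (opsum A) !=set0 <->
  exists y, forall i, pd_op A p i (y i) (- mxact (Gamma R p) y i).
Proof.
split=> [[x [u Au sum_u]]|[y row_y]].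
  exists [ffun i => if i == p then x else u i] => i.
  rewrite mxact_Gamma /pd_op !ffunE eqxx.
  have [->|ip] := eqVneq i p; last by rewrite sub0r opprK; exact: Au.
  rewrite (bigD1 p) //= ffunE eqxx addrC addrK; move: sum_u; rewrite (bigD1 p) //=.
  move=> /eqP; rewrite addr_eq0 => /eqP sum_u.
  under eq_bigr => j /negbTE jp do rewrite ffunE jp.
  by rewrite -sum_u; exact: Au.
exists (y p), (fun i => if i == p then y p - \sum_j y j else y i).
  move=> i; have := row_y i; rewrite mxact_Gamma /pd_op opprB.
  by case: eqP => [->//|_]; rewrite subr0.
rewrite (bigD1 p) //= eqxx [in X in X + _](bigD1 p) //= opprD addrA subrr sub0r addrC.
by apply/eqP; rewrite subr_eq0; apply/eqP/eq_bigr => i /negbTE ->.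
Qed.

End PrimalDual.

(** * Resolvents with a p-kernel *)

Section PKernel.
Variables (R : realType) (H : hilbertType R) (n : nat) (F : {set 'I_n}).
Variables (p : 'I_n) (M : 'M[R]_n).
Hypothesis M_ker : is_pkernel F p M.
Notation L := (M + Gamma R p).

(** Gamma_p vanishes on the diagonal, so the diagonal term is that of M. *)
Lemma pkernel_row (y : {ffun 'I_n -> H}) i :
  mxact L y i = \sum_(j < n | (j < i)%N) L i j *: y j + M i i *: y i.
Proof.
have [_ /is_trig_mxP L_trig _ _] := M_ker.
rewrite ffunE (bigID (fun j : 'I_n => (j < i)%N)) /=; congr (_ + _).
rewrite (bigD1 i) ?ltnn //= big1 => [|j /andP[ij ji]].
  by rewrite addr0 !mxE subrr addr0.
by rewrite L_trig ?scale0r // ltn_neqAle leqNgt ij andbT eq_sym.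
Qed.

(** Besides the single-valuedness of (M + Phi)^-1, this records how its value
    is computed, with coefficients that do not depend on A. *)
Lemma pkernel_solve :
  exists (c : 'I_n -> row_coef R) (ev : 'I_n -> optuple H F -> H -> H),
    [/\ forall i, 0 < rc_gamma (c i),
        forall i A r, oracle A i (rc_gamma (c i)) (rc_delta (c i) *: r) =
          [set ev i A r] &
        forall (A : optuple H F) (b : {ffun 'I_n -> H}), exists y : {ffun 'I_n -> H},
          opinv (opadd (op_of_map (mxact M)) (Phi A p)) b = [set y] /\
          forall i, let r := b i - \sum_(j < n | (j < i)%N) L i j *: y j in
            y i = rc_alpha (c i) *: r + rc_beta (c i) *: ev i A r].
Proof.
have [pNF _ M_ge0 M_eq0] := M_ker.
have /choice[c c_sol] := fun i => row_solve H pNF (M_ge0 i) (M_eq0 i).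
pose ev i A r := sval (cid ((c_sol i).2 A r)).
have ev_sol i A r := svalP (cid ((c_sol i).2 A r)).
exists c, ev; split=> [i|i A r|A b]; [exact: (c_sol i).1|exact: (ev_sol i A r).1|].
have [y y_sol] := forward_substitution L b (fun i r =>
  rc_alpha (c i) *: r + rc_beta (c i) *: ev i A r).
exists y; split; last exact/y_sol.
suff invP y' : opinv (opadd (op_of_map (mxact M)) (Phi A p)) b y' <-> y' = y.
  by apply/seteqP; split => y' /invP.
pose r (i : 'I_n) := b i - \sum_(j < n | (j < i)%N) L i j *: y' j.
have rowP i : pd_op A p i (y' i) (b i - mxact L y' i) <->
    y' i = rc_alpha (c i) *: r i + rc_beta (c i) *: ev i A (r i).
  by rewrite pkernel_row opprD addrA; exact: (ev_sol i A (r i)).2.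
rewrite -y_sol pd_inclusionP.
by split=> row_y' i; apply/rowP/row_y'.
Qed.

(** Once y_i is known, adding y_i times column i of [C] to the state updates
    both the running value of T and the residuals of all later rows.  The
    residual of row i changes too, but it is not read again. *)
Lemma representation_frugal (d : nat) (N : 'M[R]_(n, d)) (U : 'M[R]_d)
    (V : 'M[R]_(d, n)) (T : parameterized H F {ffun 'I_d -> H} {ffun 'I_d -> H}) :
  (0 < d)%N -> has_representation T p M N U V ->
  (forall A : optuple H F, fix_points (T A) !=set0 <-> zer (opsum A) !=set0) ->
  is_frugal_splitting T.
Proof.
move=> d0 T_rep T_fix.
have [c [ev [c_gt0 ev_oracle solve]]] := pkernel_solve.
pose C := col_mx V (- L).
pose S (i : 'I_n) : parameterized H F {ffun 'I_(d + n) -> H} {ffun 'I_(d + n) -> H} :=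
  fun A x => let r := x (rshift d i) in
    x + mxact (col i C) [ffun=> rc_alpha (c i) *: r + rc_beta (c i) *: ev i A r].
apply: (@frugal_of_trajectory _ _ _ _ _ _ (col_mx (1%:M - U) N) (row_mx 1%:M 0) S) => //.
- by case: (n) p => [[]|].
- by rewrite addn_gt0 d0.
- move=> i; pose e : 'rV[R]_(d + n) := delta_mx 0 (rshift d i).
  exists (1%:M + rc_alpha (c i) *: (col i C *m e)), (rc_beta (c i) *: col i C),
    (rc_delta (c i) *: e), (rc_gamma (c i)); split=> // A x.
  exists (ev i A (x (rshift d i))).
    by rewrite -ev_oracle mxactZl mxact_delta ffunE.
  rewrite /S mxactDl mxact1 -addrA; congr (_ + _); apply/ffunP => k.
  rewrite [in RHS]ffunE !mxactZl mxactM mxact_delta !ffunE !big_ord1 !ffunE.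
  by rewrite scalerDr !scalerA ![_ * col i C _ _]mulrC.
move=> A z; have [y [invM row_y]] := solve A (mxact N z).
have [y' invM' ->] := T_rep A z.
have {invM'} -> : y' = y.
  have : [set y'] y by rewrite -invM' invM.
  by move=> /= ->.
(* The state before step k, when the rows of index below k are solved. *)
pose X k := mxact (col_mx (1%:M - U) N) z +
  mxact C [ffun j : 'I_n => if (j < k)%N then y j else 0].
exists X; split.
- rewrite /X [X in mxact C X](_ : _ = 0) ?mxact0 ?addr0 //.
- move=> i.
  have r_eq : X i (rshift d i) =
      mxact N z i - \sum_(j < n | (j < i)%N) L i j *: y j.
    rewrite /X !ffunE; congr (_ + _); first by apply: eq_bigr => j _; rewrite col_mxEd.
    rewrite -sumrN [RHS]big_mkcond; apply: eq_bigr => j _; rewrite ffunE col_mxEd mxE.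
    by case: ifP => _; rewrite ?scaler0 // scaleNr.
  rewrite /S r_eq -row_y mxact_col /X -addrA -mxactDr; congr (_ + mxact _ _).
  apply/ffunP => j; rewrite !ffunE ltnS leq_eqVlt.
  have [->|ji] := eqVneq j i; first by rewrite eqxx ltnn add0r.
  by rewrite (_ : (j == i :> nat) = false) ?addr0 //; exact: negbTE.
rewrite /X mxactDr -!mxactM !mul_row_col !mul0mx !addr0 !mul1mx mxactDl mxact1 mxactNl.
by congr (_ + mxact _ _); apply/ffunP => j; rewrite ffunE ltn_ord.
Qed.

(** With G one recovers M y = M K z from the fixed-point equation, and with Q
    one finds, for a zero y of Phi, a z with M K z = M y. *)
Lemma representation_fix (d : nat) (K : 'M[R]_(n, d)) (D : 'M[R]_(d, n))
    (T : parameterized H F {ffun 'I_d -> H} {ffun 'I_d -> H}) :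
  (exists Q, M = M *m K *m Q) -> (exists G, M = G *m (D *m M)) ->
  has_representation T p M (M *m K) (D *m M *m K) (D *m M) ->
  forall A : optuple H F, fix_points (T A) !=set0 <-> zer (opsum A) !=set0.
Proof.
move=> [Q MQ] [G MG] T_rep A; rewrite (zer_opsumP p); split=> [[z Tz]|[y row_y]].
  have [y invM] := T_rep A z; rewrite {}Tz -addrA => /eqP.
  rewrite -subr_eq0 opprD addrA subrr add0r oppr_eq0 addrC subr_eq0 => /eqP My.
  have {}My : mxact M y = mxact (M *m K) z.
    by rewrite MG mxactM My -mxactM -!mulmxA.
  exists y => i.
  have /pd_inclusionP/(_ i) : opinv (opadd (op_of_map (mxact M)) (Phi A p))
      (mxact (M *m K) z) y by rewrite invM.
  by rewrite -My mxactDl [(mxact M y + _) _]ffunE opprD addrA subrr add0r.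
exists (mxact Q y); have [y' invM TQy] := T_rep A (mxact Q y).
have yy' : y = y'.
  suff : opinv (opadd (op_of_map (mxact M)) (Phi A p)) (mxact (M *m K) (mxact Q y)) y.
    by rewrite invM.
  apply/pd_inclusionP => i; have := row_y i.
  by rewrite -mxactM -MQ mxactDl [(mxact M y + _) _]ffunE opprD addrA subrr add0r.
rewrite /fix_points /= TQy -yy' -mxactM -(mulmxA D) -(mulmxA D) -MQ subrK //.
Qed.

End PKernel.

Theorem proposition6p5 (R : realType) (H : hilbertType R) (dimH : dim_ge2 H)
    (n : nat) (n_gt0 : (0 < n)%N) (F : {set 'I_n})
    (F_strict : F \proper [set: 'I_n]%SET) (p : 'I_n) (pNF : p \notin F)
    (M : 'M[R]_n) (d : nat) (kerM : is_pkernel F p M) (rankM : \rank M = d) :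
  (forall (K : 'M[R]_(n, d)) (L : 'M[R]_(d, n)),
     mxran K = orthc (mxker M) ->
     mxker L = orthc (mxran M) ->
     exists T : parameterized H F {ffun 'I_d -> H} {ffun 'I_d -> H},
       has_representation T p M (M *m K) (L *m M *m K) (L *m M) /\
       is_frugal_splitting T) /\
  (exists (K : 'M[R]_(n, d)) (L : 'M[R]_(d, n)),
     mxran K = orthc (mxker M) /\ mxker L = orthc (mxran M)).
Proof.
split; last by subst d; exact: exists_factors.
move=> K L ranK kerL.
have d_gt0 : (0 < d)%N.
  rewrite -rankM lt0n mxrank_eq0; apply: contra pNF => /eqP M0.
  by have [_ _ _ M_eq0] := kerM; apply/M_eq0; rewrite M0 mxE.
have [c [ev [_ _ solve]]] := pkernel_solve H kerM.
have /choice[y y_sol] : forall w : optuple H F * {ffun 'I_d -> H},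
    exists y : {ffun 'I_n -> H},
      opinv (opadd (op_of_map (mxact M)) (Phi w.1 p)) (mxact (M *m K) w.2) = [set y].
  by move=> [A z]; have [y []] := solve A (mxact (M *m K) z); exists y.
pose T : parameterized H F {ffun 'I_d -> H} {ffun 'I_d -> H} :=
  fun A z => z - mxact (L *m M *m K) z + mxact (L *m M) (y (A, z)).
have T_rep : has_representation T p M (M *m K) (L *m M *m K) (L *m M).
  by move=> A z; exists (y (A, z)) => //; exact: (y_sol (A, z)).
exists T; split=> //; apply: (representation_frugal kerM d_gt0 T_rep).
apply: representation_fix T_rep; first by apply: factor_right; rewrite ranK.
by apply: factor_left; rewrite kerL.
Qed.
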